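(* Let $k_1, k_2 > 0$ and define $L:\mathbb{R}\to\mathbb{R}$ by $L(z) = k_1 z$ for $z \geq 0$ and $L(z) = -k_2 z$ for $z < 0$. Let $Z$ be a real random variable with probability density function $f$ such that $f(x) = f(-x)$ for all $x \in \mathbb{R}$, $f(x) \geq f(y)$ whenever $0 \leq x \leq y$, and $\mathbb{E}[Z^2] < \infty$. Let $C$ be a minimizer of $c \mapsto \mathbb{E}[L(Z+c)]$ over $c \in \mathbb{R}$. Then $$\mathrm{Var}[L(Z+C)] \leq \mathrm{Var}[L(Z)],$$ and equality holds only when $C = 0$, which happens exactly when $k_1 = k_2$.
   Context: $Z$ models a forecast error $\hat y - y$; $L$ is an asymmetric piecewise-linear loss. $\mathbb{E}$ and $\mathrm{Var}$ denote expectation and variance. *)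

(* Defs.v *)
From HB Require Import structures.
From mathcomp Require Import all_boot all_order all_algebra.
From mathcomp Require Import all_classical all_reals all_analysis.
Set Implicit Arguments. Unset Strict Implicit. Unset Printing Implicit Defensive.
Import Order.TTheory GRing.Theory Num.Theory.
Local Open Scope ring_scope.

Definition aloss (R : realType) (k1 k2 : R) (z : R) : R :=
  if 0 <= z then k1 * z else - k2 * z.

(* Main.v *)
Require Import Defs.
From HB Require Import structures.
From mathcomp Require Import all_boot all_order all_algebra.
From mathcomp Require Import all_classical all_reals all_analysis.
From mathcomp Require Import measurable_realfun ring lra.
Import Order.TTheory GRing.Theory Num.Theory.
Local Open Scope classical_set_scope.
Local Open Scope ring_scope.

(** Let [t = - C] and [p = P(Z > t)].  Optimality of [C] is the quantile
equation [(k1 + k2) p = k2]; as [p] is decreasing with [p = 1/2] at [t = 0],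
the case [k1 = k2] is [t = 0], and by the symmetry [Z -> - Z], which swaps
[k1] and [k2], the remaining case is [t > 0].  Write [A = E (Z - t)^+] and
[M], [U1], [U2] for the moments of orders 0, 1, 2 of [Z] restricted to [(0, t]].
Using [E Z = 0], [P(Z > 0) = 1/2] and the quantile equation, the decrease of
the variance is exactly [(k1 + k2)^2] times
[2 M U2 - U1^2 + 4 M t A + 2 M t^2 p - t^2 p^2 - 2 U1 A - 2 U1 t p].
It is positive because [U1 <= t M], [U1^2 <= M U2] (Cauchy-Schwarz) and
[p^2 t <= 2 M A].  The last bound is where unimodality enters: beyond [t] the
density is at most [f t], so [A >= p^2 / (2 f t)], while on [(0, t]] it is at
least [f t], so [M >= t f t]. *)

Set Implicit Arguments.
Unset Strict Implicit.

(** * Means of integrable functions *)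

Section mean.
Context d (T : measurableType d) (R : realType) (mu : probability T R).

(** Bundling integrability with the value lets sums, multiples and comparisons of means carry their
    own integrability proofs. *)
Definition has_mean (g : T -> R) (m : R) : Prop :=
  mu.-integrable setT (EFin \o g) /\ \int[mu]_x g x = m.

Lemma has_mean_integrable g : mu.-integrable setT (EFin \o g) ->
  has_mean g (\int[mu]_x g x).
Proof. by []. Qed.

Lemma has_mean_unique g m n : has_mean g m -> has_mean g n -> m = n.
Proof. by move=> [_ <-] [_ <-]. Qed.

Lemma eq_has_mean g h m : g =1 h -> has_mean g m -> has_mean h m.
Proof. by move=> /funext ->. Qed.

Lemma eq_has_mean_val g m n : m = n -> has_mean g m -> has_mean g n.
Proof. by move=> ->. Qed.

Lemma has_mean_cst c : has_mean (fun=> c) c.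
Proof.
split; first exact: finite_measure_integrable_cst.
by rewrite Rintegral_cst//= probability_setT mulr1.
Qed.

Lemma has_meanD g h m n : has_mean g m -> has_mean h n ->
  has_mean (fun x => g x + h x) (m + n).
Proof.
move=> [ig <-] [ih <-]; split; last by rewrite RintegralD.
exact: (@integrableD _ _ _ mu setT measurableT (EFin \o g) (EFin \o h)).
Qed.

Lemma has_meanZ c g m : has_mean g m -> has_mean (fun x => c * g x) (c * m).
Proof.
move=> [ig <-]; split; last by rewrite RintegralZl.
exact: (@integrableZl _ _ _ mu setT measurableT c (EFin \o g)).
Qed.

Lemma le_has_mean g h m n : has_mean g m -> has_mean h n ->
  (forall x, g x <= h x) -> m <= n.
Proof. by move=> [ig <-] [ih <-] gh; apply: le_Rintegral => // x _. Qed.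

Lemma has_mean_indic (A : set T) : measurable A -> has_mean \1_A (fine (mu A)).
Proof.
move=> mA; split; first exact: integrable_indic.
by rewrite /Rintegral integral_indic// setIT.
Qed.

End mean.

(** * Truncated moments and integration of piecewise quadratics *)

Definition upper_moment (R : realType) (mu : probability R R) (k : nat) (s : R) : R :=
  \int[mu]_x (x ^+ k * (s < x)%R%:R).

Arguments has_mean {d T R} mu g m.
Arguments has_meanZ {d T R mu} c [g m].

Section quad_step.
Context (R : realType) (mu : probability R R).
Hypothesis mu2 : mu.-integrable setT (EFin \o (fun x : R => x ^+ 2)).

Local Notation upper_moment := (upper_moment mu).

Lemma integrable_quad_growth (g : R -> R) (K : R) :
  measurable_fun setT g ->
  (forall x, `|g x| <= K * (1 + x ^+ 2)) -> mu.-integrable setT (EFin \o g).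
Proof.
move=> mg gK.
apply: (@le_integrable _ _ _ mu setT measurableT _
  (EFin \o (fun x : R => K * (1 + x ^+ 2)))).
- exact/measurable_EFinP.
- by move=> x _ /=; rewrite lee_fin (le_trans (gK x))// ler_norm.
- by have [] := has_meanZ K (has_meanD (has_mean_cst mu 1) (has_mean_integrable mu2)).
Qed.

Lemma expr_le_quad (x : R) (k : nat) : (k <= 2)%N -> `|x ^+ k| <= 1 + x ^+ 2.
Proof.
have Hx : `|x| ^+ 2 = x ^+ 2 by rewrite -normrX ger0_norm// sqr_ge0.
have x0 := normr_ge0 x.
rewrite normrX -Hx; case: k => [|[|[|]]]// _; rewrite ?expr0 ?expr1; nra.
Qed.

Lemma measurable_step (s : R) : measurable_fun setT (fun x : R => (s < x)%R%:R : R).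
Proof.
rewrite (_ : (fun _ => _) = \1_`]s, +oo[).
  exact: measurable_indic.
by apply/funext => x; rewrite indicE mem_setE in_itv/= andbT.
Qed.

Lemma has_mean_upper k s : (k <= 2)%N ->
  has_mean mu (fun x => x ^+ k * (s < x)%R%:R) (upper_moment k s).
Proof.
move=> k2; apply: has_mean_integrable; apply: (@integrable_quad_growth _ 1).
  by apply: measurable_funM; [exact: exprn_measurable|exact: measurable_step].
move=> x; rewrite mul1r normrM (le_trans _ (expr_le_quad x k2))//.
by rewrite ler_piMr// normr_nat lern1 leq_b1.
Qed.

(** Two breakpoints cover every integrand met below, so an inequality between moments reduces to a
    pointwise one, settled by comparing [x] with [s] and [t]. An unneeded breakpoint gets zero
    coefficients. *)
Lemma has_mean_quad_step a0 a1 a2 b0 b1 b2 c0 c1 c2 s t :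
  has_mean mu (fun x => a0 + a1 * x + a2 * x ^+ 2
      + (b0 + b1 * x + b2 * x ^+ 2) * (s < x)%R%:R
      + (c0 + c1 * x + c2 * x ^+ 2) * (t < x)%R%:R)
    (a0 + a1 * \int[mu]_x x + a2 * \int[mu]_x (x ^+ 2)
      + (b0 * upper_moment 0 s + b1 * upper_moment 1 s + b2 * upper_moment 2 s)
      + (c0 * upper_moment 0 t + c1 * upper_moment 1 t + c2 * upper_moment 2 t)).
Proof.
have hx : has_mean mu (fun x => x) (\int[mu]_x x).
  apply: has_mean_integrable; apply: (@integrable_quad_growth _ 1) => // x.
  by rewrite mul1r -{1}(expr1 x) expr_le_quad.
have hs r d0 d1 d2 : has_mean mu
    (fun x => (d0 + d1 * x + d2 * x ^+ 2) * (r < x)%R%:R)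
    (d0 * upper_moment 0 r + d1 * upper_moment 1 r + d2 * upper_moment 2 r).
  apply: eq_has_mean (has_meanD (has_meanD
    (has_meanZ d0 (has_mean_upper (k := 0) r isT))
    (has_meanZ d1 (has_mean_upper (k := 1) r isT)))
    (has_meanZ d2 (has_mean_upper (k := 2) r isT))) => x /=.
  by ring.
apply: has_meanD => //; apply: has_meanD => //.
apply: has_meanD; last exact/has_meanZ/has_mean_integrable.
by apply: has_meanD; [exact: has_mean_cst|exact: has_meanZ].
Qed.

End quad_step.

(** * Reflection symmetry, tail bounds and the excess *)

Section symmetric_unimodal.
Context (R : realType) (mu : probability R R) (f : R -> R).
Hypothesis mu2 : mu.-integrable setT (EFin \o (fun x : R => x ^+ 2)).
Hypothesis mf : measurable_fun setT f.
Hypothesis f_ge0 : forall x, 0 <= f x.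
Hypothesis mu_density : forall A : set R, measurable A ->
  mu A = (\int[lebesgue_measure]_(x in A) (f x)%:E)%E.
Hypothesis f_even : forall x, f x = f (- x).
Hypothesis f_nincr : forall x y, 0 <= x -> x <= y -> f y <= f x.

Local Notation upper_moment := (upper_moment mu).
Local Notation tail := (upper_moment 0).

Lemma law_opp (A : set R) : measurable A -> mu (-%R @^-1` A) = mu A.
Proof.
move=> mA.
have mNA : measurable (-%R @^-1` A : set R).
  by rewrite -[X in measurable X]setTI; exact: oppr_measurable.
rewrite !mu_density//.
transitivity (\int[pushforward lebesgue_measure
    (-%R : _ -> measurableTypeR R)]_(x in A) (f x)%:E)%E.
  rewrite ge0_integral_pushforward//=.
  - by apply: eq_integral => x _ /=; rewrite -f_even.
  - by apply/measurable_EFinP; exact: measurable_funTS.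
  - by move=> y _; rewrite lee_fin.
by apply: eq_measure_integral => //= B mB _; exact: lebesgue_measureN.
Qed.

Lemma has_mean_opp g m : has_mean mu g m ->
  has_mean mu (fun x => g (- x)) m.
Proof.
move=> [ig <-].
(* Nonnegative functions come first, by pushing [mu] forward along negation; [g] is then split into
   its positive and negative parts. *)
have E (h : R -> \bar R) : measurable_fun setT h -> (forall x, (0 <= h x)%E) ->
    (\int[mu]_x h (- x)%R = \int[mu]_x h x)%E.
  move=> mh h0; transitivity
      (\int[pushforward mu (-%R : R -> R)]_x h x)%E.
    by rewrite ge0_integral_pushforward.
  by apply: eq_measure_integral => //= B mB _; exact: law_opp.
have mEg : measurable_fun setT (EFin \o g) by exact: measurable_int ig.
have mg : measurable_fun setT g by exact/measurable_EFinP.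
have mgN : measurable_fun setT (fun x : R => (g (- x))%:E).
  by apply/measurable_EFinP; exact: measurableT_comp.
split.
  apply/integrableP; split=> //.
  rewrite (E (fun x => `|(g x)%:E|%E)) //; last exact: measurableT_comp.
  by move/integrableP: ig => [].
congr fine; rewrite integralE [RHS]integralE; congr (_ - _)%E.
  rewrite -[RHS]E//; last exact: measurable_funepos.
  by apply: eq_integral => x _; rewrite !funeposE.
rewrite -[RHS]E//; last exact: measurable_funeneg.
by apply: eq_integral => x _; rewrite !funenegE.
Qed.

Lemma tailB a b : a <= b -> tail a - tail b = fine (mu `]a, b]%classic).
Proof.
move=> ab; rewrite -[- tail b]mulN1r.
apply: (@has_mean_unique _ _ _ mu \1_`]a, b]%classic); last exact: has_mean_indic.
apply: eq_has_mean (has_meanD (has_mean_upper mu2 (k := 0) a isT)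
  (has_meanZ (-1) (has_mean_upper mu2 (k := 0) b isT))) => x.
  rewrite indicE mem_setE in_itv/=.
  case: (ltP a x) => ax; case: (ltP b x) => bx /=; try ring.
  by have := lt_le_trans bx (le_trans _ ab); lra.
Qed.

Lemma le_tailB a b K : a <= b -> (forall x, a < x <= b -> f x <= K) ->
  tail a - tail b <= K * (b - a).
Proof.
rewrite le_eqVlt => /predU1P[<-|ab] fK; first by rewrite !subrr mulr0.
rewrite (tailB (ltW ab)) -lee_fin fineK ?fin_num_measure// mu_density//.
have -> : (K * (b - a))%:E = (\int[lebesgue_measure]_(x in `]a, b]) cst K%:E x)%E.
  by rewrite integral_cst//= lebesgue_measure_itv/= lte_fin ab -EFinB -EFinM.
apply: ge0_le_integral => //=.
- by move=> x _; rewrite lee_fin.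
- by apply/measurable_EFinP; exact: measurable_funTS.
Qed.

Lemma ge_tailB a b K : 0 <= K -> a <= b -> (forall x, a < x <= b -> K <= f x) ->
  K * (b - a) <= tail a - tail b.
Proof.
move=> K0; rewrite le_eqVlt => /predU1P[<-|ab] fK; first by rewrite !subrr mulr0.
rewrite (tailB (ltW ab)) -lee_fin fineK ?fin_num_measure// mu_density//.
have -> : (K * (b - a))%:E = (\int[lebesgue_measure]_(x in `]a, b]) cst K%:E x)%E.
  by rewrite integral_cst//= lebesgue_measure_itv/= lte_fin ab -EFinB -EFinM.
apply: ge0_le_integral => //=.
- by apply/measurable_EFinP; exact: measurable_funTS.
Qed.

Lemma density_le_mode x : f x <= f 0.
Proof.
have [x0|/ltW x0] := leP 0 x; first exact: f_nincr.
by rewrite f_even; apply: f_nincr; rewrite ?oppr_ge0.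
Qed.

Lemma tailB_le a b : a <= b -> tail a - tail b <= f 0 * (b - a).
Proof. by move=> ab; apply: le_tailB => // x _; exact: density_le_mode. Qed.

(** Stands in for limits: the tail is Lipschitz with constant [f 0], so shifting a point by [e]
    costs at most a multiple of [e]. *)
Lemma le_of_le_addM (a b K : R) : 0 <= K ->
  (forall e, 0 < e -> a <= b + K * e) -> a <= b.
Proof.
move=> K0 abK; apply/ler_addgt0Pr => e e0.
have K1 : 0 < K + 1 by lra.
apply: (le_trans (abK (e / (K + 1)) (divr_gt0 e0 K1))).
by rewrite lerD2l mulrCA ger_pMr// ler_pdivrMr// mul1r; lra.
Qed.

Lemma has_mean_upper_opp k s : (k <= 2)%N ->
  has_mean mu (fun x => (- x) ^+ k * (s < - x)%R%:R) (upper_moment k s).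
Proof. by move=> k2; exact: has_mean_opp (has_mean_upper mu2 s k2). Qed.

Lemma mean_eq0 : \int[mu]_x x = 0.
Proof.
have h : has_mean mu (fun x => x) (\int[mu]_x x).
  apply: has_mean_integrable; apply: (@integrable_quad_growth _ mu mu2 _ 1) => // x.
  by rewrite mul1r -{1}(expr1 x) expr_le_quad.
have hN : has_mean mu (fun x => - x) (-1 * \int[mu]_x x).
  by apply: eq_has_mean (has_meanZ (-1) h) => x; rewrite mulN1r.
by have := has_mean_unique (has_mean_opp h) hN; lra.
Qed.

Lemma upper_moment2_0 : 2 * upper_moment 2 0 = \int[mu]_x (x ^+ 2).
Proof.
rewrite mulrDl !mul1r; apply: has_mean_unique (has_mean_integrable mu2).
apply: eq_has_mean (has_meanD (has_mean_upper mu2 0 (leqnn 2))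
  (has_mean_upper_opp 0 (leqnn 2))) => x.
rewrite oppr_gt0; case: (ltgtP x 0) => [_|_|->] /=; ring.
Qed.

(** By symmetry [tail (- t)] is the probability of [Z < t], so the content is that [t] carries no
    mass. *)
Lemma tail_opp t : tail (- t) + tail t = 1.
Proof.
have hN := has_mean_upper_opp (- t) (isT : (0 <= 2)%N).
have hc := has_mean_cst mu 1.
have h s := has_mean_upper mu2 s (isT : (0 <= 2)%N).
apply/le_anti/andP; split.
  apply: (le_has_mean (has_meanD hN (h t)) hc) => x.
  rewrite ltrN2 !expr0 !mul1r.
  by case: (ltgtP x t) => _ /=; lra.
(* The sets [x < t] and [t - e < x] cover the line, and replacing [t - e] by [t] costs at most
   [f 0 * e]. *)
apply: (@le_of_le_addM _ _ (f 0)) => // e e0.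
have : 1 <= tail (- t) + tail (t - e).
  apply: (le_has_mean hc (has_meanD hN (h (t - e)))) => x.
  rewrite ltrN2 !expr0 !mul1r.
  case: (ltP x t) => xt; case: (ltP (t - e) x) => ex /=; lra.
have : tail (t - e) - tail t <= f 0 * (t - (t - e)) by apply: tailB_le; lra.
lra.
Qed.

(* The mean of [(Z - t)^+]. *)
Definition excess (t : R) : R := upper_moment 1 t - t * tail t.

Lemma excess_ge0 t : 0 <= excess t.
Proof.
have := le_has_mean (has_mean_cst mu 0)
  (has_mean_quad_step mu2 0 0 0 (- t) 1 0 0 0 0 t 0).
rewrite /excess => H; apply: (le_trans (H _)); last lra.
by move=> x; case: (ltP t x) => tx /=; lra.
Qed.

(** The left side is the mean of [Z - t] over [Z > t + s]; the part of the excess coming from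
    [(t, t + s]] is dropped. *)
Lemma excess_step t s : 0 <= s -> s * tail (t + s) + excess (t + s) <= excess t.
Proof.
move=> s0.
have := le_has_mean (has_mean_cst mu 0)
  (has_mean_quad_step mu2 0 0 0 (- t) 1 0 t (-1) 0 t (t + s)).
rewrite /excess => H; rewrite -subr_ge0; apply: (le_trans (H _)); last lra.
by move=> x; case: (ltP t x) => tx; case: (ltP (t + s) x) => tsx /=; lra.
Qed.

(* A Riemann sum of [tail] over [[t, t + n s]], which avoids integrating
   against the density. *)
Lemma excess_riemann t s n : 0 <= t -> 0 <= s ->
  excess (t + n%:R * s) + n%:R * s * tail t - f t * s ^+ 2 * (n%:R * (n%:R + 1)) / 2
    <= excess t.
Proof.
move=> t0 s0; elim: n => [|n IH]; first by rewrite !(mul0r, mulr0, addr0, subr0).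
have n0 : 0 <= n%:R :> R by [].
have hs : tail t - tail (t + n.+1%:R * s) <= f t * (t + n.+1%:R * s - t).
  apply: le_tailB => [|x /andP[tx _]]; first by rewrite lerDl mulr_ge0.
  by apply: f_nincr => //; exact: ltW.
have := excess_step (t + n%:R * s) s0.
have E : t + n%:R * s + s = t + n.+1%:R * s by rewrite -natr1; ring.
rewrite E => hstep.
have {hs} := ler_wpM2l s0 hs.
move: hstep IH; rewrite -natr1; lra.
Qed.

(** Integrating the linear lower bound [tail t - f t * (u - t)] for [tail u] over [[t, t + s]] gives
    this value; it is reached as the limit of Riemann sums of mesh [s / n.+1]. *)
Lemma excess_ge t s : 0 <= t -> 0 <= s ->
  s * tail t - f t * s ^+ 2 / 2 <= excess t.
Proof.
move=> t0 s0; apply: (@le_of_le_addM _ _ (f t * s ^+ 2 / 2)).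
  by rewrite divr_ge0// mulr_ge0// sqr_ge0.
move=> e e0; have [n] := ltr_add_invr e0; rewrite add0r => ne.
have n0 : 0 < n.+1%:R :> R by [].
have := @excess_riemann t (s / n.+1%:R) n.+1 t0 (divr_ge0 s0 (ltW n0)).
rewrite mulrCA divff ?gt_eqF// mulr1.
(* The discretization error is the factor [1 + 1 / n.+1], and [n] was chosen with [1 / n.+1 < e]. *)
have -> : f t * (s / n.+1%:R) ^+ 2 * (n.+1%:R * (n.+1%:R + 1)) / 2 =
    f t * s ^+ 2 / 2 + f t * s ^+ 2 / 2 * n.+1%:R^-1.
  by field; rewrite gt_eqF.
have := excess_ge0 (t + s).
have : f t * s ^+ 2 / 2 * n.+1%:R^-1 <= f t * s ^+ 2 / 2 * e.
  by rewrite ler_wpM2l ?(ltW ne)// divr_ge0// mulr_ge0// sqr_ge0.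
set u := _ / n.+1%:R; set v := _ * e; set w := _ / 2; lra.
Qed.

(** * Inequalities for the moments on [(0, t]] *)

Lemma tail0 : tail 0 = 1 / 2.
Proof. by have := tail_opp 0; rewrite oppr0; lra. Qed.

Lemma tail_excess t : 0 < t -> 0 < tail t ->
  tail t ^+ 2 * t <= 2 * (tail 0 - tail t) * excess t.
Proof.
move=> t0 p0; have A0 := excess_ge0 t.
have mt : f t * (t - 0) <= tail 0 - tail t.
  apply: ge_tailB => // [|x /andP[/ltW x0 xt]]; first exact: ltW.
  exact: f_nincr.
(* If [f t = 0], [excess_ge] reads [s * tail t <= excess t] for all [s >= 0]; the chosen [s] would
   give [excess t + 1 <= excess t]. *)
have [m0|m0] := eqVneq (f t) 0.
  have := @excess_ge t ((excess t + 1) / tail t) (ltW t0).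
  rewrite m0 divfK ?gt_eqF// divr_ge0 ?(ltW p0)//; last lra.
  by move=> /(_ isT); lra.
have {}m0 : 0 < f t by rewrite lt_neqAle eq_sym m0 f_ge0.
(* This [s] maximizes the quadratic lower bound of [excess_ge]. *)
have := @excess_ge t (tail t / f t) (ltW t0) (divr_ge0 (ltW p0) (ltW m0)).
have -> : tail t / f t * tail t - f t * (tail t / f t) ^+ 2 / 2 =
    tail t ^+ 2 / (2 * f t) by field; rewrite gt_eqF.
rewrite ler_pdivrMr; last by rewrite mulr_gt0.
move=> /(ler_wpM2r (ltW t0)) => hp.
have := ler_wpM2l A0 mt.
lra.
Qed.

Lemma trunc_moment1_le t : 0 <= t ->
  upper_moment 1 0 - upper_moment 1 t <= t * (tail 0 - tail t).
Proof.
move=> t0.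
have := le_has_mean (has_mean_cst mu 0)
  (has_mean_quad_step mu2 0 0 0 t (-1) 0 (- t) 1 0 0 t).
move=> H; rewrite -subr_ge0; apply: (le_trans (H _)); last lra.
by move=> x; case: (ltP 0 x) => ? ; case: (ltP t x) => ? /=; lra.
Qed.

(** The integral of [(M * x - U) ^+ 2] over [(0, t]] is nonnegative and equals
    [M * (M * V - U ^+ 2)]; then [M > 0] is divided out. *)
Lemma trunc_moment_cauchy t : 0 <= t -> 0 < tail 0 - tail t ->
  (upper_moment 1 0 - upper_moment 1 t) ^+ 2 <=
  (tail 0 - tail t) * (upper_moment 2 0 - upper_moment 2 t).
Proof.
move=> t0; set M := tail 0 - tail t; set U := _ - _; set V := _ - _ => M0.
have := le_has_mean (has_mean_cst mu 0)
  (has_mean_quad_step mu2 0 0 0 (U ^+ 2) (- (2 * M * U)) (M ^+ 2)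
     (- U ^+ 2) (2 * M * U) (- M ^+ 2) 0 t).
move=> H; rewrite -subr_ge0 -(pmulr_rge0 _ M0).
apply: (le_trans (H _)); last by rewrite /M /U /V; lra.
move=> x; have := sqr_ge0 (M * x - U).
by case: (ltP 0 x) => ? ; case: (ltP t x) => ? /=; lra.
Qed.

(* Twice [M U2 - U1^2], plus [U1^2], plus nonnegative terms; when [U1 = 0] the
   slack [2 M t A >= t^2 p^2 > 0] takes over. *)
Lemma variance_gap_gt0 (t p M U1 U2 A : R) : 0 < t -> 0 < p -> 0 <= A ->
  U1 <= t * M -> U1 ^+ 2 <= M * U2 -> p ^+ 2 * t <= 2 * M * A ->
  0 < 2 * M * U2 - U1 ^+ 2 + 4 * M * t * A + 2 * M * t ^+ 2 * p
      - t ^+ 2 * p ^+ 2 - 2 * U1 * A - 2 * U1 * t * p.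
Proof.
move=> t0 p0 A0 hU1 hU2 hA.
have h1 : 0 <= A * (t * M - U1) by rewrite mulr_ge0// subr_ge0.
have h2 : 0 <= t * p * (t * M - U1).
  by rewrite mulr_ge0 ?subr_ge0// mulr_ge0// ltW.
have h3 : 0 <= t * (2 * M * A - p ^+ 2 * t).
  by rewrite mulr_ge0 ?subr_ge0// ltW.
have [U0|U0] := eqVneq U1 0.
  have : 0 < t ^+ 2 * p ^+ 2 by rewrite mulr_gt0// exprn_gt0.
  move: h1 h2 h3 hU2; rewrite U0; lra.
have : 0 < U1 ^+ 2 by rewrite exprn_even_gt0.
lra.
Qed.

(** * Risk and variance of the shifted loss *)

Definition risk (k1 k2 t : R) : R := \int[mu]_x aloss k1 k2 (x - t).

Definition loss_variance (k1 k2 t : R) : R :=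
  \int[mu]_x (aloss k1 k2 (x - t) ^+ 2) - risk k1 k2 t ^+ 2.

Lemma alossE (k1 k2 t x : R) : aloss k1 k2 (x - t) =
  k2 * (t - x) + (k1 + k2) * (x - t) * (t < x)%R%:R.
Proof.
rewrite /aloss subr_ge0; case: (ltgtP t x) => [_|_|->] /=; ring.
Qed.

Lemma has_mean_aloss k1 k2 t : has_mean mu (fun x => aloss k1 k2 (x - t))
  (k2 * t + (k1 + k2) * excess t).
Proof.
have := has_mean_quad_step mu2 (k2 * t) (- k2) 0 (- (k1 + k2) * t) (k1 + k2) 0
  0 0 0 t 0.
rewrite mean_eq0 => H; apply: eq_has_mean_val (eq_has_mean _ H).
  by rewrite /excess; ring.
by move=> x; rewrite alossE; ring.
Qed.

Lemma has_mean_aloss_sqr k1 k2 t :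
  has_mean mu (fun x => aloss k1 k2 (x - t) ^+ 2)
    (k2 ^+ 2 * (\int[mu]_x (x ^+ 2) + t ^+ 2) + (k1 ^+ 2 - k2 ^+ 2) *
      (upper_moment 2 t - 2 * t * upper_moment 1 t + t ^+ 2 * tail t)).
Proof.
have := has_mean_quad_step mu2 (k2 ^+ 2 * t ^+ 2) (- (2 * k2 ^+ 2 * t)) (k2 ^+ 2)
  ((k1 ^+ 2 - k2 ^+ 2) * t ^+ 2) (- (2 * (k1 ^+ 2 - k2 ^+ 2) * t))
  (k1 ^+ 2 - k2 ^+ 2) 0 0 0 t 0.
rewrite mean_eq0 => H; apply: eq_has_mean_val (eq_has_mean _ H); first by ring.
by move=> x; rewrite alossE; case: (t < x)%R => /=; ring.
Qed.

Lemma loss_varianceE k1 k2 t : loss_variance k1 k2 t =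
  k2 ^+ 2 * (\int[mu]_x (x ^+ 2) + t ^+ 2) + (k1 ^+ 2 - k2 ^+ 2) *
      (upper_moment 2 t - 2 * t * upper_moment 1 t + t ^+ 2 * tail t)
  - (k2 * t + (k1 + k2) * excess t) ^+ 2.
Proof.
rewrite /loss_variance /risk.
have [_ ->] := has_mean_aloss k1 k2 t.
by have [_ ->] := has_mean_aloss_sqr k1 k2 t.
Qed.

(** Formally the risk has derivative [k2 - (k1 + k2) * tail t]. Instead of differentiating,
    convexity fixes the sign of this expression at [t + e] and [t - e], and the Lipschitz bound on
    the tail removes [e]. *)
Lemma risk_first_order k1 k2 t : 0 < k1 -> 0 < k2 ->
  (forall s, risk k1 k2 t <= risk k1 k2 s) -> (k1 + k2) * tail t = k2.
Proof.
move=> k10 k20 tmin; have f00 := f_ge0 0.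
have slope s : 0 <= (t - s) * ((k1 + k2) * tail s - k2).
  (* A subgradient at [x - s] of the convex loss bounds its increment from
     [x - t] to [x - s]. *)
  have h1 := has_mean_aloss k1 k2 t; have h2 := has_mean_aloss k1 k2 s.
  have := has_meanD h1 (has_mean_quad_step mu2 (- ((t - s) * k2)) 0 0
    ((t - s) * (k1 + k2)) 0 0 0 0 0 s 0).
  move=> /(le_has_mean h2) H.
  have := tmin s; rewrite /risk; have [_ ->] := h1; have [_ ->] := h2.
  move=> /le_trans hm; have {H} := hm _ (H _).
  suff hx x : aloss k1 k2 (x - s) <= aloss k1 k2 (x - t) +
      (- ((t - s) * k2) + 0 * x + 0 * x ^+ 2 +
       ((t - s) * (k1 + k2) + 0 * x + 0 * x ^+ 2) * (s < x)%R%:R +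
       (0 + 0 * x + 0 * x ^+ 2) * (0 < x)%R%:R).
    by move=> /(_ hx); lra.
  rewrite !alossE; case: (ltP t x) => tx; case: (ltP s x) => sx /=; try lra.
    have : 0 <= (k1 + k2) * (x - t) by rewrite mulr_ge0; lra.
    lra.
  have : 0 <= (k1 + k2) * (t - x) by rewrite mulr_ge0; lra.
  lra.
apply/le_anti/andP; split.
  apply: (@le_of_le_addM _ _ ((k1 + k2) * f 0)) => [|e e0].
    by rewrite mulr_ge0// addr_ge0// ltW.
  have := slope (t + e).
  have -> : t - (t + e) = - e by ring.
  rewrite mulNr -mulrN pmulr_rge0// => h.
  have hl : tail t - tail (t + e) <= f 0 * (t + e - t) by apply: tailB_le; lra.
  have := ler_wpM2l (ltW (addr_gt0 k10 k20)) hl.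
  lra.
apply: (@le_of_le_addM _ _ ((k1 + k2) * f 0)) => [|e e0].
  by rewrite mulr_ge0// addr_ge0// ltW.
have := slope (t - e).
have -> : t - (t - e) = e by ring.
rewrite pmulr_rge0// => h.
have hl : tail (t - e) - tail t <= f 0 * (t - (t - e)) by apply: tailB_le; lra.
have := ler_wpM2l (ltW (addr_gt0 k10 k20)) hl.
lra.
Qed.

Lemma loss_variance_lt k1 k2 t : 0 < k1 -> 0 < k2 -> 0 < t ->
  (k1 + k2) * tail t = k2 ->
  loss_variance k1 k2 t < loss_variance k1 k2 0 /\ k1 != k2.
Proof.
move=> k10 k20 t0 ht.
have K0 : 0 < k1 + k2 by rewrite addr_gt0.
have p0 : 0 < tail t by rewrite -(pmulr_rgt0 _ K0) ht.
have A0 := excess_ge0 t.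
have hA := tail_excess t0 p0.
(* In [hA] the left side is positive and [excess t] is nonnegative, which forces the other factor to
   be positive. *)
have M0 : 0 < tail 0 - tail t.
  have : 0 < tail t ^+ 2 * t by rewrite mulr_gt0// exprn_gt0.
  move=> /lt_le_trans/(_ hA) h; rewrite ltNge; apply/negP => M0.
  have := mulr_le0_ge0 M0 A0; lra.
split; last first.
  (* Equal slopes would give [tail t = 1 / 2 = tail 0], against [M0]. *)
  by apply/eqP => k12; move: ht M0; rewrite tail0 k12; nra.
have := variance_gap_gt0 t0 p0 A0 (trunc_moment1_le (ltW t0))
  (trunc_moment_cauchy (ltW t0) M0) hA.
move=> /(mulr_gt0 (exprn_gt0 2 K0)) gap; rewrite -subr_gt0.
move: gap; congr (is_true (0 < _)).
(* With both slopes expressed through [K] and [tail t], the variance decrease is [K ^+ 2] times the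
   gap polynomial, identically. *)
have k2E : k2 = (k1 + k2) * tail t by [].
rewrite !loss_varianceE -upper_moment2_0 /excess tail0.
set K := k1 + k2 in k2E *; have -> : k1 = K - k2 by rewrite /K; ring.
by rewrite k2E; field.
Qed.

Lemma aloss_opp (k1 k2 x : R) : aloss k1 k2 (- x) = aloss k2 k1 x.
Proof. by rewrite /aloss oppr_ge0; case: (ltgtP x 0) => [_|_|->] /=; ring. Qed.

(** Reflecting [Z] preserves its law and swaps the slopes, which reduces a negative [t] to a
    positive one. *)
Lemma risk_opp k1 k2 t : risk k1 k2 t = risk k2 k1 (- t).
Proof.
apply: (has_mean_unique _ (has_mean_integrable (has_mean_aloss k2 k1 (- t)).1)).
apply: eq_has_mean (has_mean_opp (has_mean_integrable (has_mean_aloss k1 k2 t).1)).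
by move=> x /=; rewrite -aloss_opp; congr aloss; ring.
Qed.

Lemma loss_variance_opp k1 k2 t : loss_variance k1 k2 t = loss_variance k2 k1 (- t).
Proof.
rewrite /loss_variance -risk_opp; congr (_ - _).
apply: (has_mean_unique _ (has_mean_integrable (has_mean_aloss_sqr k2 k1 (- t)).1)).
apply: eq_has_mean (has_mean_opp (has_mean_integrable (has_mean_aloss_sqr k1 k2 t).1)).
by move=> x /=; rewrite -aloss_opp; congr (aloss _ _ _ ^+ 2); ring.
Qed.

Lemma loss_variance_minimizer k1 k2 t : 0 < k1 -> 0 < k2 ->
  (forall s, risk k1 k2 t <= risk k1 k2 s) ->
  [/\ loss_variance k1 k2 t <= loss_variance k1 k2 0,
      loss_variance k1 k2 t = loss_variance k1 k2 0 -> t = 0 &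
      t = 0 <-> k1 = k2].
Proof.
move=> k10 k20 /(risk_first_order k10 k20) ht.
have [t0|t0|t0] := ltgtP t 0.
(* The quantile equation of the reflected problem, obtained from [tail_opp]. *)
- have ht' : (k2 + k1) * tail (- t) = k1.
    by have -> : tail (- t) = 1 - tail t by [rewrite -(tail_opp t); ring]; lra.
  have := loss_variance_lt k20 k10 _ ht'; rewrite oppr_gt0 => /(_ t0).
  rewrite -{1}loss_variance_opp -{1}oppr0 -loss_variance_opp => -[vlt /eqP k12].
  split; [exact: ltW|by move=> E; move: vlt; rewrite E ltxx|].
  by split=> [E|/esym//]; move: t0; rewrite E ltxx.
- have [vlt /eqP k12] := loss_variance_lt k10 k20 t0 ht.
  split; [exact: ltW|by move=> E; move: vlt; rewrite E ltxx|].
  by split=> [E|//]; move: t0; rewrite E ltxx.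
- rewrite t0; split=> //; split=> // _.
  (* At [t = 0] the quantile equation reads [(k1 + k2) / 2 = k2]. *)
  by move: ht; rewrite t0 tail0; lra.
Qed.

End symmetric_unimodal.

(** * From the law of [Z] back to the random variable *)

Section law.
Context d (T : measurableType d) (R : realType) (P : probability T R).
Context (Z : {RV P >-> R}).

Lemma expectation_law (g : R -> R) m : has_mean (distribution P Z) g m ->
  'E_P[fun w => g (Z w)]%E = m%:E.
Proof.
move=> [ig <-]; have mg := measurable_int _ ig.
have mZ : measurable_fun setT (Z : T -> R) by [].
have igZ : P.-integrable setT (EFin \o g \o Z).
  apply/integrableP; split; first exact: measurableT_comp.
  move/integrableP: ig => [_].
  by rewrite ge0_integral_distribution//; exact: measurableT_comp.
rewrite unlock -(@integral_distribution _ _ _ _ _ P Z (EFin \o g))//.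
by rewrite /Rintegral fineK// integrable_fin_num.
Qed.

Lemma variance_law (g : R -> R) m n : has_mean (distribution P Z) g m ->
  has_mean (distribution P Z) (fun x => g x ^+ 2) n ->
  'V_P[fun w => g (Z w)]%E = (n - m ^+ 2)%:E.
Proof.
move=> hg hg2; rewrite /variance unlock (expectation_law hg)/=.
(* Variance unfolds to the covariance of a variable with itself, hence the product rather than a
   square. *)
apply: (@expectation_law (fun x => (g x - m) * (g x - m))).
apply: eq_has_mean_val (eq_has_mean _ (has_meanD hg2
  (has_meanD (has_meanZ (- (2 * m)) hg) (has_mean_cst _ (m ^+ 2))))).
  by ring.
by move=> x; ring.
Qed.

End law.

Theorem theorem1 (R : realType) (d : measure_display) (T : measurableType d)
  (P : probability T R) (Z : {RV P >-> R}) (f : R -> R) (k1 k2 C : R) :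
  0 < k1 -> 0 < k2 ->
  (* f is a probability density function of Z (w.r.t. Lebesgue measure) *)
  measurable_fun setT f ->
  (forall x, 0 <= f x) ->
  (forall A : set R, measurable A ->
     distribution P Z A = (\int[lebesgue_measure]_(x in A) (f x)%:E)%E) ->
  (forall x, f x = f (- x)) ->
  (forall x y, 0 <= x -> x <= y -> f y <= f x) ->
  ('E_P[fun w => (Z w ^+ 2)%R] < +oo)%E ->
  (* C minimizes c |-> E[L(Z + c)] *)
  (forall c : R, ('E_P[fun w => (aloss k1 k2 (Z w + C))%R]
                    <= 'E_P[fun w => (aloss k1 k2 (Z w + c))%R])%E) ->
  ('V_P[fun w => (aloss k1 k2 (Z w + C))%R] <= 'V_P[fun w => (aloss k1 k2 (Z w))%R])%E
  /\ ('V_P[fun w => (aloss k1 k2 (Z w + C))%R] = 'V_P[fun w => (aloss k1 k2 (Z w))%R]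
        -> C = 0)
  /\ (C = 0 <-> k1 = k2).
Proof.
move=> k10 k20 mf f_ge0 dens f_even f_nincr Z2 Cmin.
pose mu : probability R R := distribution P Z.
have mu2 : mu.-integrable setT (EFin \o (fun x : R => x ^+ 2)).
  have mE : measurable_fun setT (EFin \o (fun x : R => x ^+ 2)).
    by apply/measurable_EFinP; exact: exprn_measurable.
  apply/integrableP; split => //.
  rewrite ge0_integral_distribution//; last exact: measurableT_comp.
  move: Z2; rewrite unlock; congr (_ < _)%E.
  by apply: eq_integral => w _ /=; rewrite ger0_norm// sqr_ge0.
have loss_mean t := has_mean_aloss mu2 mf f_ge0 dens f_even k1 k2 t.
have loss2_mean t := has_mean_aloss_sqr mu2 mf f_ge0 dens f_even k1 k2 t.
have risk_E c : 'E_P[fun w => aloss k1 k2 (Z w + c)]%E = (risk mu k1 k2 (- c))%:E.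
  rewrite -(expectation_law (has_mean_integrable (loss_mean (- c)).1)).
  by congr expectation; apply/funext => w; rewrite opprK.
have var_E c : 'V_P[fun w => aloss k1 k2 (Z w + c)]%E =
    (loss_variance mu k1 k2 (- c))%:E.
  rewrite -(variance_law (has_mean_integrable (loss_mean (- c)).1)
    (has_mean_integrable (loss2_mean (- c)).1)).
  by congr variance; apply/funext => w; rewrite opprK.
have var0_E : 'V_P[fun w => aloss k1 k2 (Z w)]%E = (loss_variance mu k1 k2 0)%:E.
  by rewrite -oppr0 -var_E; congr variance; apply/funext => w; rewrite addr0.
(* Any threshold [s] is the shift [c = - s], so minimality over [c] is minimality over [s]. *)
have riskmin s : risk mu k1 k2 (- C) <= risk mu k1 k2 s.
  by rewrite -lee_fin -risk_E -[s]opprK -risk_E.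
have [vle veq t0] := loss_variance_minimizer mu2 mf f_ge0 dens f_even f_nincr
  k10 k20 riskmin.
rewrite var_E var0_E lee_fin; split=> //; split.
  by move=> [/veq/eqP]; rewrite oppr_eq0 => /eqP.
by rewrite -t0; split=> [->|/eqP]; rewrite ?oppr0// oppr_eq0 => /eqP.
Qed.
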